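(* Let $\sigma>0$ and $X=C(\mathbb{S}^1_\sigma)$. Let $e^{-it\Delta_g}(x,y)$ be the Schwartz kernel of the Schr\''odinger propagator $e^{-it\Delta_g}$ on $X$, i.e. the fundamental solution of the Schr\''odinger equation, given for $t\in\mathbb{R}\setminus\{0\}$, $x=(r_1,\theta_1)$, $y=(r_2,\theta_2)$ by $$e^{-it\Delta_g}(x,y)=\frac1{4\pi}\frac{e^{-\frac{r_1^2+r_2^2}{4it}}}{it}\sum_{\{j\in\mathbb{Z}:\,0\le|\theta_1-\theta_2+2j\sigma\pi|\le\pi\}}e^{\frac{r_1r_2}{2it}\cos(\theta_1-\theta_2+2j\sigma\pi)}-\frac{1}{4\pi^2\sigma}\frac{e^{-\frac{r_1^2+r_2^2}{4it}}}{it}\int_0^\infty e^{-\frac{r_1r_2}{2it}\cosh s}A_\sigma(s,\theta_1,\theta_2)\,ds,$$ with $$A_\sigma(s,\theta_1,\theta_2)=\operatorname{Im}\left(\frac{e^{\frac{i}{\sigma}(\pi-(\theta_1-\theta_2))}}{e^{\frac{s}{\sigma}}-e^{\frac{i}{\sigma}(\pi-(\theta_1-\theta_2))}}-\frac{e^{-\frac{i}{\sigma}(\pi+(\theta_1-\theta_2))}}{e^{\frac{s}{\sigma}}-e^{-\frac{i}{\sigma}(\pi+(\theta_1-\theta_2))}}\right).$$ Then there is a constant $C_\sigma$, depending only on $\sigma$ (in particular independent of $x,y$ and $t$), such that $$|e^{-it\Delta_g}(x,y)|\le C_\sigma|t|^{-1}\qquad\text{for all }x,y\in X,\ t\in\m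athbb{R}\setminus\{0\}.$$
   Context: Setting: $\sigma>0$, $\mathbb{S}^1_\sigma=\mathbb{R}/2\pi\sigma\mathbb{Z}$ is the circle of radius $\sigma$, and $X=C(\mathbb{S}^1_\sigma)=(0,\infty)_r\times(\mathbb{S}^1_\sigma)_\theta$ is the flat Euclidean cone with metric $g=dr^2+r^2d\theta^2$ and measure $r\,dr\,d\theta$. $\Delta_g$ is the positive Laplace–Beltrami operator $-\partial_r^2-\frac1r\partial_r-\frac1{r^2}\partial_\theta^2$ on $L^2(X,r\,dr\,d\theta)$, defined as the Friedrichs extension from the domain $C_c^\infty(X)$ of smooth functions compactly supported in the interior of the cone. Schwartz kernels are taken with respect to the measure $r\,dr\,d\theta$. $\theta_1,\theta_2$ denote real representatives of points of $\mathbb{S}^1_\sigma$; the set-indexed sum over $j$ and the function $A_\sigma$ do not depend on the choice of representatives. *)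

(* Defs.v *)
From HB Require Import structures.
From mathcomp Require Import all_boot all_order all_algebra.
From mathcomp Require Import all_classical all_reals all_analysis.
From mathcomp Require Import complex.

Set Implicit Arguments.
Unset Strict Implicit.
Unset Printing Implicit Defensive.

Import Order.TTheory GRing.Theory Num.Theory.
Import numFieldNormedType.Exports.

Local Open Scope classical_set_scope.
Local Open Scope ring_scope.
Local Open Scope complex_scope.

(** A point of the cone [X = (0, oo) x R/(2 pi sigma Z)] is written
    [(r, theta) : R * R] with [0 < r] and [theta] any real representative of
    the angle.  Integrals over [X] are integrals over one angular period,
    against the measure [r dr dtheta]; "almost everywhere" on [X] means
    Lebesgue-a.e. on that period, since the weight [r] does not vanish. *)

Definition period (R : realType) (sigma : R) : set (R * R) :=
  [set z | 0 < z.1 /\ 0 <= z.2 < 2 * pi * sigma].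

Definition leb2 (R : realType) :=
  (@lebesgue_measure R \x @lebesgue_measure R)%E.
Arguments leb2 R : clear implicits.

Definition cexp (R : realType) (z : R[i]) : R[i] :=
  (expR (complex.Re z))%:C * (cos (complex.Im z) +i* sin (complex.Im z)).

Definition cone_ae (R : realType) (sigma : R) (P : R * R -> Prop) : Prop :=
  {ae leb2 R, forall z, period sigma z -> P z}.

Definition cone_integrable (R : realType) (sigma : R) (f : R * R -> R[i]) :
    Prop :=
  (leb2 R).-integrable (period sigma) (fun z => (complex.Re (f z) * z.1)%:E) /\
  (leb2 R).-integrable (period sigma) (fun z => (complex.Im (f z) * z.1)%:E).

Definition cone_integral (R : realType) (sigma : R) (f : R * R -> R[i]) :
    R[i] :=
  (\int[leb2 R]_(z in period sigma) (complex.Re (f z) * z.1)) +i*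
  (\int[leb2 R]_(z in period sigma) (complex.Im (f z) * z.1)).

Definition inL2 (R : realType) (sigma : R) (f : R * R -> R[i]) : Prop :=
  [/\ measurable_fun (period sigma) (fun z => complex.Re (f z)),
      measurable_fun (period sigma) (fun z => complex.Im (f z)) &
      (\int[leb2 R]_(z in period sigma)
         (ComplexField.Normc.normc (f z) ^+ 2 * z.1)%:E < +oo)%E].

Definition L2inner (R : realType) (sigma : R) (f g : R * R -> R[i]) : R[i] :=
  cone_integral sigma (fun z => f z * ((g z)^*)%C).

Definition L2normsq (R : realType) (sigma : R) (f : R * R -> R[i]) : R :=
  \int[leb2 R]_(z in period sigma)
    (ComplexField.Normc.normc (f z) ^+ 2 * z.1).

Definition polar_dir (R : realType) (b : bool) : R * R :=
  if b then (1, 0) else (0, 1).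

Fixpoint iter_partial (R : realType) (w : seq bool) (u : R * R -> R) :
    R * R -> R :=
  if w is b :: w' then fun z => 'D_(polar_dir R b) (iter_partial w' u) z
  else u.

Definition smooth2 (R : realType) (u : R * R -> R) : Prop :=
  forall w : seq bool,
    continuous (iter_partial w u) /\
    forall b z, derivable (iter_partial w u) z (polar_dir R b).

(** The support of a test function stays away from the tip and from infinity,
    so extending it by [0] to [r <= 0] keeps it smooth on [R * R]. *)
Definition test_function (R : realType) (sigma : R) (f : R * R -> R[i]) :
    Prop :=
  [/\ smooth2 (fun z => complex.Re (f z)), smooth2 (fun z => complex.Im (f z)),
      forall r theta, f (r, theta + 2 * pi * sigma) = f (r, theta) &
      exists a b : R, 0 < a < b /\
        forall z, ~ (a <= z.1 <= b) -> f z = 0].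

Definition partial_r (R : realType) (f : R * R -> R[i]) (z : R * R) : R[i] :=
  'D_(polar_dir R true) (fun z => complex.Re (f z)) z +i*
  'D_(polar_dir R true) (fun z => complex.Im (f z)) z.

Definition partial_theta (R : realType) (f : R * R -> R[i]) (z : R * R) :
    R[i] :=
  'D_(polar_dir R false) (fun z => complex.Re (f z)) z +i*
  'D_(polar_dir R false) (fun z => complex.Im (f z)) z.

Definition cone_laplacian (R : realType) (f : R * R -> R[i]) (z : R * R) :
    R[i] :=
  - partial_r (partial_r f) z - (z.1^-1)%:C * partial_r f z
  - (z.1 ^- 2)%:C * partial_theta (partial_theta f) z.

Definition energy (R : realType) (sigma : R) (f : R * R -> R[i]) : R :=
  complex.Re (L2inner sigma (cone_laplacian f) f).

(** The form domain: the closure of [C_c^oo(X)] in the norm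
    [|f|^2 + <Delta f, f>], realized inside [L^2(X)]. *)
Definition form_domain (R : realType) (sigma : R) (u : R * R -> R[i]) : Prop :=
  inL2 sigma u /\
  exists phi : nat -> R * R -> R[i],
    [/\ forall n, test_function sigma (phi n),
        L2normsq sigma (fun z => phi n z - u z) @[n --> \oo] --> (0 : R) &
        forall eps : R, 0 < eps -> exists N, forall m n,
          (N <= m)%N -> (N <= n)%N ->
          energy sigma (fun z => phi m z - phi n z) < eps].

(** [friedrichs sigma u w]: [u] is in the domain of the Friedrichs extension
    [Delta_g], and [Delta_g u = w].  This is the restriction to the form domain
    of the adjoint of the Laplacian on test functions. *)
Definition friedrichs (R : realType) (sigma : R) (u w : R * R -> R[i]) : Prop :=
  [/\ form_domain sigma u, inL2 sigma w &
      forall v, test_function sigma v ->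
        L2inner sigma u (cone_laplacian v) = L2inner sigma w v].

(** [U t] is the isometry [e^{-it Delta_g}] of [L^2(X)]: for [f] in the domain
    of [Delta_g], [u(t) = U t f] stays in that domain and is differentiable in
    [L^2(X)] with [u'(t) = - i Delta_g u(t)] and [u(0) = f].  As [Delta_g] is
    self-adjoint this determines each [U t f] with [f] in [L^2(X)] up to a null
    set.  Elements of [L^2(X)] are functions, not classes; hence the
    "almost everywhere". *)
Definition schrodinger_propagator (R : realType) (sigma : R)
    (U : R -> (R * R -> R[i]) -> R * R -> R[i]) : Prop :=
  [/\ forall t f, inL2 sigma f ->
        inL2 sigma (U t f) /\ L2normsq sigma (U t f) = L2normsq sigma f,
      forall t (a : R[i]) f g, inL2 sigma f -> inL2 sigma g ->
        cone_ae sigma (fun x =>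
          U t (fun z => a * f z + g z) x = a * U t f x + U t g x),
      forall f, inL2 sigma f -> cone_ae sigma (fun x => U 0 f x = f x) &
      forall f w, friedrichs sigma f w -> forall t, exists2 w',
        friedrichs sigma (U t f) w' &
        L2normsq sigma (fun z =>
          (h^-1)%:C * (U (t + h) f z - U t f z) + 'i%C * w' z)
          @[h --> (0 : R)^'] --> (0 : R)].

Definition schwartz_kernel (R : realType) (sigma : R)
    (T : (R * R -> R[i]) -> R * R -> R[i]) (k : R * R -> R * R -> R[i]) : Prop :=
  forall f, test_function sigma f ->
    cone_ae sigma (fun x =>
      cone_integrable sigma (fun y => k x y * f y) /\
      T f x = cone_integral sigma (fun y => k x y * f y)).

Definition Asigma (R : realType) (sigma s theta1 theta2 : R) : R :=
  let e1 := cexp ('i%C / sigma%:C * (pi - (theta1 - theta2))%:C) in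
  let e2 := cexp (- ('i%C / sigma%:C) * (pi + (theta1 - theta2))%:C) in
  let es := (expR (s / sigma))%:C in
  complex.Im (e1 / (es - e1) - e2 / (es - e2)).

(** The index set is finite since [sigma <> 0]. *)
Definition geometric_sum (R : realType) (sigma t r1 theta1 r2 theta2 : R) :
    R[i] :=
  \sum_(j \in [set j : int |
      0 <= `|theta1 - theta2 + 2 * j%:~R * sigma * pi| <= pi])
    cexp ((r1 * r2)%:C / (2 * 'i%C * t%:C) *
          (cos (theta1 - theta2 + 2 * j%:~R * sigma * pi))%:C).

Definition diffractive_integrand
    (R : realType) (sigma t r1 theta1 r2 theta2 s : R) : R[i] :=
  cexp (- ((r1 * r2)%:C / (2 * 'i%C * t%:C)) * ((expR s + expR (- s)) / 2)%:C) *
  (Asigma sigma s theta1 theta2)%:C.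

Definition diffractive_integral
    (R : realType) (sigma t r1 theta1 r2 theta2 : R) : R[i] :=
  (\int[lebesgue_measure]_(s in `[0%R, +oo[)
      complex.Re (diffractive_integrand sigma t r1 theta1 r2 theta2 s)) +i*
  (\int[lebesgue_measure]_(s in `[0%R, +oo[)
      complex.Im (diffractive_integrand sigma t r1 theta1 r2 theta2 s)).

Definition cone_kernel (R : realType) (sigma t : R) (x y : R * R) : R[i] :=
  let prefactor :=
    cexp (- ((x.1 ^+ 2 + y.1 ^+ 2)%:C / (4 * 'i%C * t%:C))) / ('i%C * t%:C) in
  (1 / (4 * pi))%:C * prefactor * geometric_sum sigma t x.1 x.2 y.1 y.2
  - (1 / (4 * pi ^+ 2 * sigma))%:C * prefactor
    * diffractive_integral sigma t x.1 x.2 y.1 y.2.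

(* Main.v *)
Require Import Defs.
From mathcomp Require Import all_boot all_order all_algebra.
From mathcomp Require Import all_classical all_reals all_analysis.
From mathcomp Require Import complex.
From mathcomp Require Import measurable_realfun ring lra zify.

Import Order.TTheory GRing.Theory Num.Theory.
Import numFieldNormedType.Exports.
Local Open Scope ring_scope.
Local Open Scope complex_scope.

(** The bound is read off the explicit formula for the kernel.  For real [t]
    every exponential in that formula has a purely imaginary exponent, hence
    modulus [1], and the prefactor [1/(it)] has modulus [1/|t|].  What remains
    is to bound two quantities independently of [t], of the radii and of the
    angles.

    The geometric sum has unimodular terms, indexed by the integers [j] for
    which an affine function of [j] with slope [2 pi sigma] falls in the window
    [[-pi, pi]]; two such indices differ by at most [1/sigma], so the number of
    terms depends on [sigma] only ([normc_geometric_sum_le]).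

    The diffractive integral is at most the integral of [|A_sigma|].  When one
    of the angles [alpha = (pi - (theta1 - theta2))/sigma] and
    [beta = (pi + (theta1 - theta2))/sigma] approaches a multiple of [2 pi],
    the corresponding term of [A_sigma] concentrates near [s = 0], so that no
    pointwise bound of it is uniform in the angles.  Its [L^1] norm is
    nevertheless uniformly bounded: with [x = exp (s/sigma)],
      [Im (e^{ia} / (x - e^{ia})) = x sin a / ((x - cos a)^2 + (sin a)^2)]
    is a Poisson kernel, of constant sign for [x > 0], and
    [sigma * atan ((x - cos a) / |sin a|)] is an antiderivative in [s] of its
    absolute value ([integral_poisson_density_le]).  As the arctangent takes
    values in an interval of length [pi], each of the two terms of [A_sigma]
    contributes at most [sigma * pi], however concentrated it is. *)

(** * Domination of real integrals *)

(** The integral of a nonnegative function is a supremum over the simple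
    functions below it, and is therefore monotone even on nonmeasurable
    functions.  This spares proving that the oscillating integrand of the
    diffractive term is measurable. *)
Lemma ge0_integral_mono d (T : measurableType d) (R : realType)
    (mu : {measure set T -> \bar R}) (D : set T) (f g : T -> \bar R) :
  (forall x, D x -> (0 <= f x)%E) -> (forall x, D x -> (f x <= g x)%E) ->
  (\int[mu]_(x in D) f x <= \int[mu]_(x in D) g x)%E.
Proof.
move=> f0 fg.
have g0 x : D x -> (0 <= g x)%E.
  by move=> Dx; exact: le_trans (f0 _ Dx) (fg _ Dx).
rewrite !ge0_integralE//; apply: le_ereal_sup => _ /= [h hf <-].
exists h => // x; apply: le_trans (hf x) _.
rewrite /patch; case: ifPn => // /set_mem; exact: fg.
Qed.

(** The integrals of the positive and of the negative part of [f] both lie in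
    [[0, M]], hence so does, in absolute value, their difference; being finite,
    they make the real-valued integral the true one. *)
Lemma le_normr_Rintegral_dominated d (T : measurableType d) (R : realType)
    (mu : {measure set T -> \bar R}) (D : set T) (f g : T -> R) (M : R) :
  (forall x, D x -> `|f x| <= g x) ->
  (\int[mu]_(x in D) (g x)%:E <= M%:E)%E ->
  `|\int[mu]_(x in D) f x| <= M.
Proof.
move=> fg gM; rewrite /Rintegral integralE.
have part h : (forall x, 0 <= h x)%E -> (forall x, h x <= `|(f x)%:E|)%E ->
    exists2 a : R, 0 <= a <= M & (\int[mu]_(x in D) h x = a%:E)%E.
  move=> h0 hf; have H0 : (0 <= \int[mu]_(x in D) h x)%E by exact: integral_ge0.
  have HM : (\int[mu]_(x in D) h x <= M%:E)%E.
    apply: le_trans gM; apply: ge0_integral_mono => // x Dx.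
    by apply: le_trans (hf x) _; rewrite lee_fin fg.
  move: H0 HM; case: (\int[mu]_(x in D) h x)%E => [a| |] //.
  by rewrite !lee_fin => a0 aM; exists a => //; rewrite a0.
have bnd (y : R) : (maxe y%:E 0 <= `|y%:E|)%E /\ (maxe (- y%:E) 0 <= `|y%:E|)%E.
  rewrite abse_EFin !ge_max -EFinN !lee_fin normr_ge0 ler_norm.
  by rewrite -normrN ler_norm.
have [x|a aM ->] := part ((EFin \o f)^\+)%E (@funepos_ge0 _ _ _).
  by rewrite funeposE; have [] := bnd (f x).
have [x|b bM ->] := part ((EFin \o f)^\-)%E (@funeneg_ge0 _ _ _).
  by rewrite funenegE; have [] := bnd (f x).
rewrite -EFinB /=; move: aM bM => /andP[? ?] /andP[? ?].
rewrite ler_norml; lra.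
Qed.

(** * The Poisson kernel and its total mass *)

(** For [c = cos a] and [d = sin a] this is the absolute value of
    [Im (e^{ia} / (x - e^{ia}))], the Poisson kernel of the disc up to
    normalization. *)
Definition poisson_density {R : realType} (c d x : R) : R :=
  x * `|d| / ((x - c) ^+ 2 + d ^+ 2).

Lemma poisson_density_ge0 (R : realType) (c d x : R) :
  0 <= x -> 0 <= poisson_density c d x.
Proof. by move=> x0; rewrite divr_ge0 ?mulr_ge0 // addr_ge0 ?sqr_ge0. Qed.

Lemma poisson_density0 (R : realType) (c x : R) : poisson_density c 0 x = 0.
Proof. by rewrite /poisson_density normr0 mulr0 mul0r. Qed.

Lemma continuous_poisson_density_expR (R : realType) (sigma c d : R) :
  d != 0 -> continuous (fun s : R => poisson_density c d (expR (s / sigma))).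
Proof.
move=> d0 s; apply: differentiable_continuous; apply/derivable1_diffP.
apply: derivableM; first exact: ex_derive.
apply: derivableV; last exact: ex_derive.
by rewrite lt0r_neq0// ltr_wpDl ?sqr_ge0// exprn_even_gt0.
Qed.

Lemma measurable_poisson_density_expR (R : realType) (sigma c d : R) :
  measurable_fun [set: R] (fun s : R => poisson_density c d (expR (s / sigma))).
Proof.
have [->|d0] := eqVneq d 0.
  by under eq_fun do rewrite poisson_density0; exact: measurable_cst.
by apply: continuous_measurable_fun; exact: continuous_poisson_density_expR.
Qed.

(** The mass is bounded by the variation of the antiderivative
    [sigma * atan ((exp (s/sigma) - c) / |d|)], uniformly in [c] and [d]
    although the density takes the value [c/|d|] at [x = c]. *)
Lemma integral_poisson_density_le (R : realType) (sigma c d : R) : 0 < sigma ->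
  (\int[lebesgue_measure]_(s in `[0%R, +oo[)
      (poisson_density c d (expR (s / sigma)))%:E
   <= (sigma * pi)%:E)%E.
Proof.
move=> sigma0.
have [->|d0] := eqVneq d 0.
  rewrite integral0_eq ?lee_fin ?mulr_ge0 ?pi_ge0 ?ltW//.
  by move=> s _; rewrite poisson_density0.
have D0 e : 0 < (e - c) ^+ 2 + d ^+ 2.
  by rewrite ltr_wpDl ?sqr_ge0// exprn_even_gt0.
have nd0 : 0 < `|d| by rewrite normr_gt0.
have si : 0 < sigma^-1 by rewrite invr_gt0.
pose F (s : R) := sigma * atan ((expR (s / sigma) - c) / `|d|).
pose f (s : R) := poisson_density c d (expR (s / sigma)).
have dE (s : R) : is_derive s (1 : R) (fun s : R => expR (s / sigma))
    (expR (s / sigma) / sigma).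
  apply: (@is_derive1_comp R expR (fun s : R => s / sigma)).
  by apply: is_derive_eq; rewrite /GRing.scale/= mulr0 add0r mulr1.
pose G (s : R) := (expR (s / sigma) - c) / `|d|.
have dG (s : R) : is_derive s (1 : R) G (expR (s / sigma) / sigma / `|d|).
  by apply: is_derive_eq; rewrite /GRing.scale/= mulr0 add0r subr0 mulrC.
have dA (s : R) : is_derive s (1 : R) (fun s : R => atan (G s))
    ((1 + G s ^+ 2)^-1 * (expR (s / sigma) / sigma / `|d|)).
  exact: (@is_derive1_comp R atan G).
have dF (s : R) : is_derive s (1 : R) F (f s).
  apply: is_derive_eq; rewrite /f /poisson_density /G.
  have := D0 (expR (s / sigma)); rewrite -(real_normK (num_real d)).
  move: (expR _) `|d| nd0 => e m m0 em; rewrite /GRing.scale /=; field.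
  by rewrite !lt0r_neq0//= addrC.
have cFy : (F s @[s --> +oo%R] --> (sigma * (pi / 2))%R)%classic.
  apply: cvgMr.
  apply: (@cvg_comp _ _ _ _ atan _ (@pinfty_nbhs R)); last exact: cvgy_atan.
  apply/cvgryPge => A; near=> s.
  (* [1 + u <= exp u] makes the argument of [atan] tend to infinity *)
  rewrite ler_pdivlMr// lerBrDr (le_trans _ (expR_ge1Dx _))// -lerBlDl.
  by rewrite ler_pdivlMr.
rewrite (ge0_continuous_FTC2y _ _ cFy) -/f.
- rewrite -EFinB lee_fin /F.
  by have := atan_gtNpi2 ((expR (0 / sigma) - c) / `|d|); nra.
- by move=> x _; rewrite poisson_density_ge0 ?expR_ge0.
- exact/continuous_subspaceT/continuous_poisson_density_expR.
- by move=> x _; apply: ex_derive.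
- apply: cvg_at_right_filter; apply: differentiable_continuous.
  by apply/derivable1_diffP; apply: ex_derive.
- by move=> x _; rewrite derive1E; apply: derive_val.
Unshelve. all: by end_near.
Qed.

(** * Unimodular exponentials *)

Lemma div_imag (R : realType) (a t : R) n :
  a%:C / (n%:R * 'i * t%:C) = 'i * (- (a / (n%:R * t)))%:C :> R[i].
Proof.
rewrite !invfM -(rmorph_nat (real_complex R)) -!fmorphV.
have -> : ('i : R[i])^-1 = - 'i.
  by rewrite /GRing.inv /=; simpc; rewrite expr0n expr1n add0r invr1.
by rewrite !rmorphN !rmorphM /=; ring.
Qed.

Lemma cexp_imag (R : realType) (x : R) : cexp ('i * x%:C) = cos x +i* sin x.
Proof. by rewrite /cexp; simpc; rewrite expR0 /= !mul1r. Qed.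

Lemma normc_cexp_imag (R : realType) (x : R) : `|cexp ('i * x%:C)| = 1 :> R[i].
Proof. by rewrite cexp_imag normc_def /= cos2Dsin2 sqrtr1. Qed.

Lemma normc_real (R : rcfType) (x : R) : `|x%:C| = `|x|%:C.
Proof. by rewrite normc_def /= expr0n /= addr0 sqrtr_sqr. Qed.

Lemma normc_i (R : rcfType) : `|'i| = 1 :> R[i].
Proof. by rewrite normc_def /= expr0n expr1n /= add0r sqrtr1. Qed.

Lemma normc_le_normD (R : rcfType) (x y : R) : `|x +i* y| <= (`|x| + `|y|)%:C.
Proof.
rewrite [x +i* y]complexE /= (le_trans (ler_normD _ _))// normrM normc_i mul1r.
by rewrite !normc_real rmorphD.
Qed.

(** * The geometric term *)

Lemma normr_fsbig_le (R : rcfType) (I : choiceType) (A : set I) (r : seq I)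
    (F : I -> R[i]) :
  uniq r -> (forall i, A i -> i \in r) -> (forall i, A i -> `|F i| <= 1) ->
  `|\sum_(i \in A) F i| <= (size r)%:R.
Proof.
move=> ur Ar F1.
have -> : A = ([set` r] `&` A)%classic.
  by apply/seteqP; split => [i Ai|i []//]; split => //=; exact: Ar.
rewrite fsbig_mkcondr -fsbig_seq//; apply: le_trans (ler_norm_sum _ _ _) _.
have -> : (size r)%:R = \sum_(i <- r) 1 :> R[i].
  by rewrite big_const_seq count_predT iter_addr_0.
by apply: ler_sum => i _; case: ifPn => [/set_mem/F1//|_]; rewrite normr0 ler01.
Qed.

(** All indices lie within [1/sigma] of any one of them, hence in a window of
    [2 * N + 1] consecutive integers as soon as [N] is at least [1/sigma]. *)
Lemma normc_geometric_sum_le (R : realType) (sigma t r1 theta1 r2 theta2 : R) :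
  0 < sigma ->
  `|geometric_sum sigma t r1 theta1 r2 theta2| <=
    (2 * Num.bound sigma^-1).+1%:R :> R[i].
Proof.
move=> sigma0; rewrite /geometric_sum; set A := (X in \sum_(j \in X) _).
have [[j0 Aj0]|A0] := pselect (exists j, A j); last first.
  have -> : A = set0 by apply/seteqP; split => // j Aj; apply: A0; exists j.
  by rewrite fsbig_set0 normr0.
set N := Num.bound _.
pose r := [seq j0 + k%:Z - N%:Z | k <- iota 0 (2 * N).+1].
have -> : (2 * N).+1 = size r by rewrite size_map size_iota.
apply: normr_fsbig_le.
- by rewrite map_inj_uniq ?iota_uniq// => k l; lia.
- move=> j Aj.
  have jj0 : `|j - j0| < N%:Z.
    rewrite -(ltr_int R) (le_lt_trans _ (archi_boundP _)) ?invr_ge0//;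
      last by exact: ltW.
    (* the two angles differ by [(j - j0) * sigma * (2 * pi)], and their
       distance is at most the length [2 * pi] of the window *)
    rewrite intr_norm -[leRHS]mul1r ler_pdivlMr//.
    have pi2 : 0 < 2 * pi :> R by rewrite mulr_gt0// pi_gt0.
    rewrite -(ler_pM2r pi2) mul1r -(gtr0_norm sigma0) -{1}(gtr0_norm pi2).
    rewrite -!normrM.
    move: Aj Aj0; rewrite /A /= !normr_ge0 /= rmorphB /= !ler_norml.
    by move=> /andP[? ?] /andP[? ?]; lra.
  apply/mapP; exists (`|(j - j0 + N%:Z)%R|)%N; last by lia.
  by rewrite mem_iota; lia.
- move=> j _.
  by rewrite div_imag -(mulrA 'i) -(rmorphM (real_complex R)) normc_cexp_imag.
Qed.

(** * The diffractive term *)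

Lemma Im_geometric_quotient (R : realType) (x c d : R) :
  complex.Im ((c +i* d) / (x%:C - (c +i* d))) = x * d / ((x - c) ^+ 2 + d ^+ 2).
Proof. by rewrite /= sub0r sqrrN; ring. Qed.

(** The two quotients in [Asigma] have [e1 = e^{i alpha}] and
    [e2 = e^{- i beta}]; the density is even in the sine, so the sign of the
    second angle is immaterial. *)
Lemma normr_Asigma_le (R : realType) (sigma s theta1 theta2 : R) :
  let alpha := (pi - (theta1 - theta2)) / sigma in
  let beta := (pi + (theta1 - theta2)) / sigma in
  `|Asigma sigma s theta1 theta2| <=
    poisson_density (cos alpha) (sin alpha) (expR (s / sigma)) +
    poisson_density (cos beta) (sin beta) (expR (s / sigma)).
Proof.
move=> /=; set alpha := (pi - _) / sigma; set beta := (pi + _) / sigma.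
have quot (a : R) (e := cexp ('i * a%:C)) :
    `|complex.Im (e / ((expR (s / sigma))%:C - e))| =
    poisson_density (cos a) (sin a) (expR (s / sigma)).
  rewrite /e cexp_imag Im_geometric_quotient normrM normrM.
  rewrite ger0_norm ?expR_ge0//.
  by rewrite [X in _ * X = _]ger0_norm// invr_ge0 addr_ge0 ?sqr_ge0.
rewrite /Asigma.
have -> : 'i / sigma%:C * (pi - (theta1 - theta2))%:C = 'i * alpha%:C :> R[i].
  by rewrite /alpha rmorphM fmorphV /=; ring.
have -> : - ('i / sigma%:C) * (pi + (theta1 - theta2))%:C =
    'i * (- beta)%:C :> R[i].
  by rewrite /beta rmorphN rmorphM fmorphV /=; ring.
rewrite raddfB (le_trans (ler_normB _ _))// !quot cosN sinN.
by rewrite /poisson_density normrN sqrrN.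
Qed.

Lemma Asigma_dominated (R : realType) (sigma theta1 theta2 : R) :
  0 < sigma -> exists2 g : R -> R,
    forall s, `|Asigma sigma s theta1 theta2| <= g s &
    (\int[lebesgue_measure]_(s in `[0%R, +oo[) (g s)%:E
     <= (2 * sigma * pi)%:E)%E.
Proof.
move=> sigma0; eexists; first by move=> s; exact: normr_Asigma_le.
have P0 c d (s : R) : (0 <= (poisson_density c d (expR (s / sigma)))%:E)%E.
  by rewrite lee_fin poisson_density_ge0 ?expR_ge0.
have mP c d : measurable_fun (`[0%R, +oo[%classic : set R)
    (fun s : R => (poisson_density c d (expR (s / sigma)))%:E).
  apply/measurable_EFinP; apply: measurable_funTS.
  exact: measurable_poisson_density_expR.
under eq_integral do rewrite EFinD.
rewrite ge0_integralD//; [|exact: mP|exact: mP].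
rewrite (_ : 2 * sigma * pi = sigma * pi + sigma * pi); last by ring.
by rewrite EFinD leeD//; exact: integral_poisson_density_le.
Qed.

(** The phase is discarded: real and imaginary part of the integrand are each
    dominated by [|A_sigma|], which loses at most a factor [2]. *)
Lemma normc_diffractive_integral_le (R : realType)
    (sigma t r1 theta1 r2 theta2 : R) : 0 < sigma ->
  `|diffractive_integral sigma t r1 theta1 r2 theta2| <=
    (4 * sigma * pi)%:C.
Proof.
move=> sigma0; have [g Ag gM] := Asigma_dominated _ _ theta1 theta2 sigma0.
have cexpE s : exists y, let A := Asigma sigma s theta1 theta2 in
    diffractive_integrand sigma t r1 theta1 r2 theta2 s =
    (cos y * A) +i* (sin y * A).
  rewrite /diffractive_integrand div_imag -mulrN -rmorphN -(mulrA 'i).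
  rewrite -(rmorphM (real_complex R)) cexp_imag.
  by eexists; simpc; reflexivity.
have le_re (x y z : R) : `|x| <= 1 -> `|y| <= z -> `|x * y| <= z.
  by move=> x1 yz; rewrite normrM -[z]mul1r ler_pM.
apply: le_trans (normc_le_normD _ _ _) _; rewrite lecR.
rewrite (_ : 4 * sigma * pi = 2 * sigma * pi + 2 * sigma * pi); last by ring.
apply: lerD; apply: le_normr_Rintegral_dominated gM => s _;
  have [y ->] := cexpE s.
- by apply: le_re => //; rewrite ler_norml cos_geN1 cos_le1.
- by apply: le_re => //; rewrite ler_norml sin_geN1 sin_le1.
Qed.

(** * The dispersive estimate *)

Lemma normc_cone_kernel_le (R : realType) (sigma t : R) (x y : R * R) :
  0 < sigma ->
  `|cone_kernel sigma t x y| <=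
   (((2 * Num.bound sigma^-1).+1%:R / (4 * pi) + pi^-1) * `|t|^-1)%:C.
Proof.
move=> sigma0; rewrite /cone_kernel; set p := _ / ('i * t%:C).
have np : `|p| = (`|t|^-1)%:C.
  rewrite /p div_imag -mulrN -rmorphN normrM normc_cexp_imag.
  by rewrite mul1r normfV normrM normc_i mul1r normc_real fmorphV.
have t0 : 0 <= `|t|^-1 by rewrite invr_ge0.
have pi0 := pi_gt0 R.
have a1 : 0 <= 1 / (4 * pi) :> R by rewrite divr_ge0 ?mulr_ge0 ?ltW.
have a2 : 0 <= 1 / (4 * pi ^+ 2 * sigma) :> R.
  by rewrite divr_ge0 ?mulr_ge0 ?exprn_ge0 ?ltW.
move: p np => p np; rewrite (le_trans (ler_normB _ _))//.
rewrite !normrM np !normc_real (ger0_norm a1) (ger0_norm a2).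
have geo := normc_geometric_sum_le _ sigma t x.1 x.2 y.1 y.2 sigma0.
have dif := normc_diffractive_integral_le _ sigma t x.1 x.2 y.1 y.2 sigma0.
apply: le_trans (lerD (ler_wpM2l _ geo) (ler_wpM2l _ dif)) _.
- by rewrite -(rmorphM (real_complex R)) lecR mulr_ge0.
- by rewrite -(rmorphM (real_complex R)) lecR mulr_ge0.
rewrite -(rmorph_nat (real_complex R)) -!(rmorphM (real_complex R)).
rewrite -(rmorphD (real_complex R)) lecR le_eqVlt; apply/orP; left; apply/eqP.
move: (`|t|^-1) (_ * _).+1%:R pi pi0 => u n p0 p0_gt0; field.
by rewrite !lt0r_neq0.
Qed.

Theorem theorem3p1 (R : realType) (sigma : R) (hsigma : 0 < sigma) :
  exists C : R,
    forall (U : R -> (R * R -> R[i]) -> R * R -> R[i])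
           (K : R -> R * R -> R * R -> R[i]),
      schrodinger_propagator sigma U ->
      (forall t : R, t != 0 -> schwartz_kernel sigma (U t) (K t)) ->
      (forall (t : R) (x y : R * R), t != 0 -> 0 < x.1 -> 0 < y.1 ->
         K t x y = cone_kernel sigma t x y) ->
      forall (t : R) (x y : R * R), t != 0 -> 0 < x.1 -> 0 < y.1 ->
        `|K t x y| <= (C * `|t|^-1)%:C.
Proof.
eexists=> U K _ _ KE t x y t0 x0 y0.
by rewrite KE//; exact: normc_cone_kernel_le.
Qed.
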